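(* The inverse Langevin function $L^{-1}$ is a special case of the generalized Lambert function. Namely, the transcendental equation $L(x)=a$ can be rewritten as $$L(x)=\frac{e^{2x}+1}{e^{2x}-1}-\frac1x=a,$$ and after rearrangement and the variable substitution $x\to-\frac12x$ it is equivalent to the equation $$e^{-x}=\frac{a+1}{a-1}\,\frac{x-\frac{2}{a+1}}{x-\frac{2}{a-1}},$$ whose solution is given by $$W\left(\begin{array}{c}\frac{2}{a+1}\\[2pt] \frac{2}{a-1}\end{array};\frac{a-1}{a+1}\right).$$ Hence $$L^{-1}(a)=-\frac12\,W\left(\begin{array}{c}\frac{2}{a+1}\\[2pt] \frac{2}{a-1}\end{array};\frac{a-1}{a+1}\right).$$
   Context: All parameters and variables are real. The Langevin function is $L(x)=\coth(x)-\frac1x$, and $L^{-1}$ denotes its inverse; $a$ is a real number in the domain of $L^{-1}$. For real numbers $t,s,c$, the generalized Lambert function with one upper parameter $t$ and one lower parameter $s$, written $W\left(\begin{array}{c}t\\ s\end{array};c\right)$, is defined as the solution(s) $x$ of the equation $e^{x}\,\frac{x-t}{x-s}=c$.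
   Formalization: The root x = 0 solves the Lambert equation for every a, so the equivalence is stated for x ≠ 0, and L⁻¹(a) = −W/2 is stated for some value of W and, as an equivalence, for all nonzero values of W; L is extended by L(0) = 0. *)

(* Defs.v *)
From HB Require Import structures.
From mathcomp Require Import all_boot all_order all_algebra.
From mathcomp Require Import all_classical all_reals all_analysis.

Set Implicit Arguments.
Unset Strict Implicit.
Unset Printing Implicit Defensive.

Import Order.TTheory GRing.Theory Num.Theory.
Local Open Scope classical_set_scope.
Local Open Scope ring_scope.

Definition coth (R : realType) (x : R) : R :=
  (expR x + expR (- x)) / (expR x - expR (- x)).

(* At x = 0 both terms evaluate to 0 (inverses are total, with 0^-1 = 0), so
   langevin 0 = 0: this is the usual extension of L by continuity, and
   langevin is the Langevin function on the whole real line. *)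
Definition langevin (R : realType) (x : R) : R := coth x - x^-1.

(* Only meaningful on the domain of L^-1, which is range langevin; elsewhere
   it takes the default value 0. *)
Definition inv_langevin (R : realType) : R -> R :=
  'pinv_(fun=> 0) [set: R] (@langevin R).

(* W(t; s; c) is multivalued, hence the set of all real solutions. The equation
   is undefined at x = s, which is therefore excluded. *)
Definition gen_lambert (R : realType) (t s c : R) : set R :=
  [set x | x <> s /\ expR x * ((x - t) / (x - s)) = c].

(* Main.v *)
Require Import Defs.
From mathcomp Require Import all_boot all_order all_algebra.
From mathcomp Require Import all_classical all_reals all_analysis.
From mathcomp Require Import ring lra.

Import Order.TTheory GRing.Theory Num.Theory.
Local Open Scope classical_set_scope.
Local Open Scope ring_scope.

Set Implicit Arguments.
Unset Strict Implicit.

(** Clearing denominators in L(-x/2) = a gives, for nonzero x, the equation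
    e^(-x) ((a-1) x - 2) = (a+1) x - 2, which is at once the displayed equation
    and the equation defining W; this is pure algebra once a is neither 1 nor
    -1. Two facts about L supply the rest. First, L takes its values in
    ]-1, 1[ ([langevin_lt1], [langevin_gtN1]): for x > 0 the claim
    coth x < 1 + 1/x is 1 + 2x < e^(2x). Second, L is injective
    ([langevin_inj]), so that L(y) = a and y = L^-1(a) are the same equation:
    L is odd, positive on x > 0, and increasing there because its derivative
    1/x^2 - 1/sinh(x)^2 is positive, as sinh x > x. The cleared equation has
    the root x = 0 for every a, whereas L(0) = a only for a = 0; hence the
    restriction to nonzero values of W in the converse. *)

(** * Monotonicity of the Langevin function *)

(** The derivative has to be positive only to the right of x, so that x = 0 is
    admissible for the functions below whose derivative vanishes there. *)
Lemma lt_is_derive_gt0 (R : realType) (f df : R -> R) (x y : R) : x < y ->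
    (forall z, x <= z -> is_derive z 1 f (df z)) ->
    (forall z, x < z -> 0 < df z) ->
  f x < f y.
Proof.
move=> xy fdf df0.
have [||c] := @MVT R f df x y xy.
- by move=> z; rewrite in_itv/= => /andP[/ltW xz _]; exact: fdf.
- apply: derivable_within_continuous => z; rewrite in_itv/= => /andP[xz _].
  by have [] := fdf z xz.
- rewrite in_itv/= => /andP[xc _] fE.
  by rewrite -subr_gt0 fE mulr_gt0 ?df0// subr_gt0.
Qed.

Lemma is_derive_expRN (R : realType) (x : R) :
  is_derive x 1 (fun y => expR (- y)) (- expR (- x)).
Proof.
have D := @is_derive1_comp R expR -%R x (expR (- x)) (-1) _ _.
by apply: is_derive_eq (D _ _) _; rewrite mulrN1.
Qed.

(** This is x < sinh x, doubled. The derivative inequality e^x + e^(-x) > 2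
    follows from the tangent bound e^x > 1 + x at x and at -x. *)
Lemma expR_sub_expRN_gt (R : realType) (x : R) : 0 < x ->
  2 * x < expR x - expR (- x).
Proof.
move=> x0; rewrite -subr_gt0.
pose f y : R := expR y - expR (- y) - 2 * y.
suff : f 0 < f x by rewrite /f oppr0 subrr mulr0 subr0.
apply: (@lt_is_derive_gt0 _ _ (fun y => expR y + expR (- y) - 2)) => // z z0.
- have D := @is_derive_expRN R z.
  apply: is_derive_eq.
  by rewrite opprK; congr (_ - _); rewrite /GRing.scale/= mulr1.
- have := @expR_gt1Dx R z (lt0r_neq0 z0).
  have := @expR_gt1Dx R (- z); rewrite oppr_eq0 lt0r_neq0// => /(_ isT).
  lra.
Qed.

Lemma is_derive_langevin (R : realType) (x : R) : 0 < x ->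
  is_derive x 1 (@langevin R) (x ^- 2 - 4 / (expR x - expR (- x)) ^+ 2).
Proof.
move=> x0.
have s0 : expR x - expR (- x) != 0.
  by apply: lt0r_neq0; have := expR_sub_expRN_gt x0; lra.
have D := @is_derive_expRN R x.
have xn0 := lt0r_neq0 x0.
have DV : is_derive x 1 (fun y : R => (expR y - expR (- y))^-1)
    (- (expR x - expR (- x)) ^- 2 *: (expR x - - expR (- x))).
  by apply: is_deriveV.
have Dx : is_derive x 1 (fun y : R => y^-1) (- x ^- 2 *: (1 : R)).
  by apply: is_deriveV.
have E := expRxMexpNx_1 x.
rewrite /langevin /coth.
apply: is_derive_eq; rewrite /GRing.scale/=.
(* The numerator 4 comes from cosh^2 - sinh^2 = 1. *)
have -> : 4 = 4 * (expR x * expR (- x)) by rewrite E mulr1.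
field.
by rewrite s0 xn0.
Qed.

Lemma langevin_mono_gt0 (R : realType) (x y : R) : 0 < x -> x < y ->
  langevin x < langevin y.
Proof.
move=> x0 xy.
have D z : x <= z -> _ :=
  fun xz => is_derive_langevin (lt_le_trans x0 xz).
apply: (lt_is_derive_gt0 xy D) => z xz.
have z0 : 0 < z := lt_trans x0 xz.
have s2z := expR_sub_expRN_gt z0.
set s := expR z - expR (- z) in s2z *.
have s0 : 0 < s by lra.
have -> : z ^- 2 - 4 / s ^+ 2 = (s - 2 * z) * (s + 2 * z) / (z ^+ 2 * s ^+ 2).
  by field; rewrite !lt0r_neq0.
by rewrite divr_gt0 ?mulr_gt0 ?exprn_gt0//; lra.
Qed.

(** * The closed form, the bounds and the injectivity *)

Lemma langevin_closed_form (R : realType) (x : R) : x <> 0 ->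
  langevin x = (expR (2 * x) + 1) / (expR (2 * x) - 1) - 1 / x.
Proof.
move=> /eqP xn0; rewrite /langevin /coth div1r; congr (_ - _).
have e0 : expR x != 0 by rewrite expR_eq0.
have e2 : expR (2 * x) = expR x ^+ 2 by rewrite expRM_natl.
have e1 : expR (2 * x) - 1 != 0.
  by rewrite subr_eq0 -expR0 (inj_eq (@expR_inj R)) mulf_neq0// pnatr_eq0.
by rewrite e2 in e1 *; rewrite expRN; field; rewrite e0 e1.
Qed.

Lemma langevin0 (R : realType) : langevin (0 : R) = 0.
Proof. by rewrite /langevin /coth oppr0 !(subrr, invr0, mulr0). Qed.

Lemma langevinN (R : realType) (x : R) : langevin (- x) = - langevin x.
Proof.
rewrite /langevin /coth opprK invrN.
by rewrite -[expR (- x) - expR x]opprB invrN mulrN [expR (- x) + _]addrC -opprD.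
Qed.

(** Over a common denominator, 1 - L(x) has numerator e^(2x) - 1 - 2x. *)
Lemma langevin_lt1_gt0 (R : realType) (x : R) : 0 < x -> langevin x < 1.
Proof.
move=> x0; have xn0 := lt0r_neq0 x0.
rewrite langevin_closed_form; last exact/eqP.
have x2 : 0 < 2 * x by lra.
have := expR_gt1Dx (lt0r_neq0 x2); set E := expR _ => E2x.
have E1 : 0 < E - 1 by lra.
rewrite -subr_gt0.
have -> : 1 - ((E + 1) / (E - 1) - 1 / x) = (E - 1 - 2 * x) / (x * (E - 1)).
  by field; rewrite lt0r_neq0// xn0.
by rewrite divr_gt0 ?mulr_gt0//; lra.
Qed.

(** Positivity means sinh x < x cosh x; the difference of the two sides
    vanishes at 0 and has derivative x sinh x. *)
Lemma langevin_gt0 (R : realType) (x : R) : 0 < x -> 0 < langevin x.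
Proof.
move=> x0.
pose f y : R := y * (expR y + expR (- y)) - (expR y - expR (- y)).
have fx : f 0 < f x.
  apply: (@lt_is_derive_gt0 _ _ (fun y => y * (expR y - expR (- y)))) => //.
    move=> z _; have D := @is_derive_expRN R z.
    by apply: is_derive_eq; rewrite /GRing.scale/=; ring.
  move=> z z0; rewrite mulr_gt0//.
  by have := expR_sub_expRN_gt z0; lra.
move: fx; rewrite /f oppr0 mul0r !subrr => fx.
have := expR_sub_expRN_gt x0; rewrite /langevin /coth.
set s := expR x - expR (- x) in fx *; set c := expR x + _ in fx * => xs.
have s0 : 0 < s by lra.
have -> : c / s - x^-1 = (x * c - s) / (s * x) by field; rewrite !lt0r_neq0.
by rewrite divr_gt0 ?mulr_gt0.
Qed.

Lemma langevin_lt1 (R : realType) (x : R) : langevin x < 1.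
Proof.
have [x0|x0|->] := ltgtP x 0; last by rewrite langevin0.
- rewrite -[x]opprK langevinN (@lt_trans _ _ 0)// oppr_lt0.
  by rewrite langevin_gt0// oppr_gt0.
- exact: langevin_lt1_gt0.
Qed.

Lemma langevin_gtN1 (R : realType) (x : R) : -1 < langevin x.
Proof. by rewrite -[x]opprK langevinN ltrN2 langevin_lt1. Qed.

Lemma langevin_mono (R : realType) (x y : R) : x < y ->
  langevin x < langevin y.
Proof.
move=> xy; have [x0|x0|x0] := ltgtP x 0.
- have Lx : langevin x < 0.
    by rewrite -oppr_gt0 -langevinN langevin_gt0// oppr_gt0.
  have [y0|y0|->] := ltgtP y 0; last by rewrite langevin0.
    rewrite -ltrN2 -!langevinN langevin_mono_gt0 ?oppr_gt0//.
    by rewrite ltrN2.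
  exact: lt_trans Lx (langevin_gt0 y0).
- exact: langevin_mono_gt0.
- by rewrite x0 in xy *; rewrite langevin0 langevin_gt0.
Qed.

Lemma langevin_inj (R : realType) : injective (@langevin R).
Proof.
by move=> x y; case: (ltgtP x y) => // /langevin_mono /[swap] ->; rewrite ltxx.
Qed.

Lemma inv_langevinE (R : realType) (a y : R) : range (@langevin R) a ->
  (inv_langevin a = y <-> langevin y = a).
Proof.
have inj : {in [set: R] &, injective (@langevin R)}.
  by move=> u v _ _; exact: langevin_inj.
move=> ra; split=> [<-|<-]; first by apply: pinvK; rewrite inE.
by apply: pinvKV; rewrite ?inE.
Qed.

(** * The cleared equation *)

Definition cleared_equation (R : realType) (a x : R) : Prop :=
  expR (- x) * ((a - 1) * x - 2) = (a + 1) * x - 2.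

Section cleared_equation_theory.
Variables (R : realType) (a : R).
Hypotheses (a1 : a - 1 != 0) (aN1 : a + 1 != 0).

Local Notation cleared := (cleared_equation a).

(** Subtracting a and using a common denominator, L(-x/2) - a is the difference
    of the two sides of the cleared equation divided by x (e^(-x) - 1), which
    is nonzero. *)
Lemma langevin_cleared (x : R) : x <> 0 ->
  (langevin (- (1 / 2) * x) = a <-> cleared x).
Proof.
move=> /eqP x0.
have y0 : - (1 / 2) * x <> 0.
  by apply/eqP; rewrite mulf_neq0// oppr_eq0 mul1r invr_eq0 pnatr_eq0.
rewrite langevin_closed_form//.
have -> : 2 * (- (1 / 2) * x) = - x by field.
have E1 : expR (- x) - 1 != 0.
  by rewrite subr_eq0 -expR0 (inj_eq (@expR_inj R)) oppr_eq0.
rewrite /cleared_equation; set E := expR _ in E1 *.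
have -> : (E + 1) / (E - 1) - 1 / (- (1 / 2) * x) =
    a + ((a + 1) * x - 2 - E * ((a - 1) * x - 2)) / (x * (E - 1)).
  by field; rewrite E1 x0.
split=> [/eqP|->]; last by rewrite subrr mul0r addr0.
rewrite -subr_eq0 [a + _]addrC addrK mulf_eq0 invr_eq0.
by rewrite (negbTE (mulf_neq0 x0 E1)) orbF subr_eq0 => /eqP.
Qed.

(** At x = 2 / (a - 1) the cleared equation would say that
    (a - 1) x and (a + 1) x are both 2, hence x = 0 and 0 = 2. *)
Lemma cleared_denominator_neq0 (x : R) : cleared x -> (a - 1) * x - 2 != 0.
Proof.
rewrite /cleared_equation => eqx; apply/eqP => x0.
move: eqx; rewrite x0 mulr0 => x1.
have xE : x = 0 by lra.
by move: x0; rewrite xE mulr0; lra.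
Qed.

Lemma denominator_neq0 (x : R) : (a - 1) * x - 2 != 0 <-> x <> 2 / (a - 1).
Proof.
split=> [+ xE|xE]; first by rewrite xE mulrC divfK// subrr eqxx.
by apply/eqP => /subr0_eq x2; apply: xE; rewrite -x2 mulrAC divff// mul1r.
Qed.

Lemma ratioE (x : R) : (a - 1) * x - 2 != 0 ->
  (x - 2 / (a + 1)) / (x - 2 / (a - 1)) =
  (a - 1) / (a + 1) * (((a + 1) * x - 2) / ((a - 1) * x - 2)).
Proof.
move=> xN.
have xs : x - 2 / (a - 1) != 0 by rewrite subr_eq0; apply/eqP/denominator_neq0.
by field; rewrite xN aN1 a1.
Qed.

Lemma exp_equation_cleared (x : R) :
  (x <> 2 / (a - 1) /\
    expR (- x) = (a + 1) / (a - 1) * ((x - 2 / (a + 1)) / (x - 2 / (a - 1))))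
  <-> cleared x.
Proof.
have C : (a + 1) / (a - 1) * ((a - 1) / (a + 1)) = 1 by field; rewrite a1 aN1.
split=> [[/denominator_neq0 xN]|cx].
  by rewrite ratioE// mulrA C mul1r /cleared_equation => ->; rewrite divfK.
have xN := cleared_denominator_neq0 cx; split; first exact/denominator_neq0.
by rewrite ratioE// mulrA C mul1r -cx mulfK.
Qed.

Lemma gen_lambert_cleared (x : R) :
  gen_lambert (2 / (a + 1)) (2 / (a - 1)) ((a - 1) / (a + 1)) x <-> cleared x.
Proof.
have c0 : (a - 1) / (a + 1) != 0 by rewrite mulf_neq0// invr_eq0.
have EN := expRxMexpNx_1 x.
rewrite /gen_lambert /cleared_equation/=; split=> [[/denominator_neq0 xN]|cx].
  rewrite ratioE// mulrCA -[RHS]mulr1 => /(mulfI c0).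
  rewrite mulrA => /divr1_eq xE.
  by rewrite -xE mulrA [expR (- x) * _]mulrC EN mul1r.
have xN := cleared_denominator_neq0 cx; split; first exact/denominator_neq0.
by rewrite ratioE// -cx mulfK// mulrCA EN mulr1.
Qed.

Lemma gen_lambert0 :
  gen_lambert (2 / (a + 1)) (2 / (a - 1)) ((a - 1) / (a + 1)) 0.
Proof.
apply/gen_lambert_cleared.
by rewrite /cleared_equation oppr0 expR0 !mulr0 mul1r.
Qed.

Lemma langevin_gen_lambert (x : R) : x <> 0 ->
  (langevin (- (1 / 2) * x) = a <->
   gen_lambert (2 / (a + 1)) (2 / (a - 1)) ((a - 1) / (a + 1)) x).
Proof.
by move=> x0; rewrite (langevin_cleared x0) gen_lambert_cleared.
Qed.

End cleared_equation_theory.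

Unset Implicit Arguments.

Theorem mainTheorem1 (R : realType) (a : R) (ha : range (@langevin R) a) :
  [/\ (* the rewriting of L *)
      forall x : R, x <> 0 ->
        langevin x = (expR (2 * x) + 1) / (expR (2 * x) - 1) - 1 / x,
      (* L(x) = a after rearrangement and the substitution x -> - x / 2 *)
      forall x : R, x <> 0 ->
        (langevin (- (1 / 2) * x) = a <->
         x <> 2 / (a - 1) /\
         expR (- x) =
           (a + 1) / (a - 1) * ((x - 2 / (a + 1)) / (x - 2 / (a - 1)))),
      (* the solutions of the resulting equation are the values of W *)
      [set x : R | x <> 2 / (a - 1) /\
         expR (- x) =
           (a + 1) / (a - 1) * ((x - 2 / (a + 1)) / (x - 2 / (a - 1)))] =
      gen_lambert (2 / (a + 1)) (2 / (a - 1)) ((a - 1) / (a + 1)),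
      (* L^-1(a) = - W / 2 for some value of W ... *)
      exists2 w : R,
        gen_lambert (2 / (a + 1)) (2 / (a - 1)) ((a - 1) / (a + 1)) w &
        inv_langevin a = - (1 / 2) * w
    & (* ... and for every value of W but the root x = 0, which is introduced
         by the rearrangement *)
      forall w : R, w <> 0 ->
        (gen_lambert (2 / (a + 1)) (2 / (a - 1)) ((a - 1) / (a + 1)) w <->
         inv_langevin a = - (1 / 2) * w)].
Proof.
have [a1 aN1] : a - 1 != 0 /\ a + 1 != 0.
  case: ha => y _ <-; have := langevin_lt1 y; have := langevin_gtN1 y.
  by split; [rewrite lt_eqF//|rewrite gt_eqF//]; lra.
split.
- exact: langevin_closed_form.
- move=> x x0; rewrite exp_equation_cleared//; exact: langevin_cleared.
- apply/seteqP; split=> x /=.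
    by move/(exp_equation_cleared a1 aN1)/(gen_lambert_cleared a1 aN1).
  by move/(gen_lambert_cleared a1 aN1)/(exp_equation_cleared a1 aN1).
- have LK : langevin (inv_langevin a) = a by exact/inv_langevinE.
  have wE : inv_langevin a = - (1 / 2) * (- 2 * inv_langevin a) by field.
  exists (- 2 * inv_langevin a) => //.
  (* L^-1(a) = 0 occurs for a = 0, and then the value of W is its root 0. *)
  have [->|/eqP y0] := eqVneq (- 2 * inv_langevin a) 0.
    exact: gen_lambert0.
  by apply/langevin_gen_lambert => //; rewrite -wE.
- move=> w w0; rewrite inv_langevinE//.
  by apply: iff_sym; exact: langevin_gen_lambert.
Qed.
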